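(* Let $q$ be a complex number equal to neither $0$ nor $1$. Let $\boldsymbol{\mu}$ be a multi-index and $\boldsymbol{\mu}^{*}$ its dual. Then $$(\Delta_{q,k}\, a_{\boldsymbol{\mu}})(n) = c_{\boldsymbol{\mu},\boldsymbol{\mu}^{*}}(n,k)$$ for any $n,k\in\mathbb{N}$.
   Context: $\mathbb{N}$ denotes the set of non-negative integers. For $n\in\mathbb{N}$, $[n]_q=\frac{1-q^n}{1-q}$, $[n]_q!=[n]_q[n-1]_q\cdots[1]_q$ with $[0]_q!=1$, and $\begin{bmatrix} n\\ k\end{bmatrix}_q=\frac{[n]_q!}{[k]_q!\,[n-k]_q!}$ for $0\le k\le n$. Difference operators: for $z\in\mathbb{C}$, $\Delta_z:\mathbb{C}^{\mathbb{N}}\to\mathbb{C}^{\mathbb{N}}$ is $(\Delta_z a)(n)=a(n)-z\,a(n+1)$. For $k\in\mathbb{N}$, $\Delta_{q,k}=\Delta_{q^k}\circ\Delta_{q^{k-1}}\circ\cdots\circ\Delta_{q}$, with $\Delta_{q,0}$ the identity. A multi-index is a (nonempty) finite sequence of positive integers $\boldsymbol{\mu}=(\mu_1,\ldots,\mu_p)$; its weight is $|\boldsymbol{\mu}|=\mu_1+\cdots+\mu_p$. For $m\ge1$, multi-indices of weight $m$ correspond bijectively to subsets of $\{1,\ldots,m-1\}$ via $\mathcal{S}_m(\mu_1,\ldots,\mu_p)=\{\mu_1,\ \mu_1+\mu_2,\ \ldots,\ \mu_1+\cdots+\mu_{p-1}\}$. The dual of a multi-index $\boldsymbol{\mu}$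 of weight $m$ is $\boldsymbol{\mu}^{*}=\mathcal{S}_m^{-1}(\mathcal{S}_m(\boldsymbol{\mu})^c)$, where the complement is taken in $\{1,\ldots,m-1\}$; it again has weight $m$. For a multi-index $\boldsymbol{\mu}=(\mu_1,\ldots,\mu_p)$ and $n\in\mathbb{N}$, $$a_{\boldsymbol{\mu}}(n)=\sum_{n=n_1\ge n_2\ge\cdots\ge n_p\ge0}\frac{q^{(\mu_1-1)(n_1+1)+\cdots+(\mu_p-1)(n_p+1)}}{[n_1+1]_q^{\mu_1}\cdots[n_p+1]_q^{\mu_p}}.$$ For multi-indices $\boldsymbol{\mu}=(\mu_1,\ldots,\mu_p)$ and $\boldsymbol{\nu}=(\nu_1,\ldots,\nu_r)$ of the same weight $m$ and $n,k\in\mathbb{N}$, $$c_{\boldsymbol{\mu},\boldsymbol{\nu}}(n,k)=\begin{bmatrix} n+k\\ n\end{bmatrix}_q^{-1}\sum_{\substack{n=n_1\ge\cdots\ge n_p\ge0\\ k=k_1\ge\cdots\ge k_r\ge0}}\frac{q^{(\mu_1-1)(n_1+1)+\cdots+(\mu_p-1)(n_p+1)+k_2+\cdots+k_r}}{[n_{i_1}+k_{j_1}+1]_q\cdots[n_{i_m}+k_{j_m}+1]_q},$$ where $(i_1,\ldots,i_m)=(\underbrace{1,\ldots,1}_{\mu_1},\underbrace{2,\ldots,2}_{\mu_2},\ldots,\underbrace{p,\ldots,p}_{\mu_p})$ and $(j_1,\ldots,j_m)=(\underbrace{1,\ldots,1}_{\nu_1},\underbrace{2,\ldots,2}_{\n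u_2},\ldots,\underbrace{r,\ldots,r}_{\nu_r})$.
   Formalization: The formal statement additionally assumes [j]_q ≠ 0 for 1 ≤ j ≤ n+k+1; otherwise (q a root of unity of small order, e.g. q = −1, μ = (1), n = 0, k = 1) the formula divides by zero and is undefined. *)

(* Defs.v *)
From mathcomp Require Import all_boot all_order all_algebra.
From mathcomp Require Import reals.
From mathcomp Require Export complex.

Set Implicit Arguments.
Unset Strict Implicit.
Unset Printing Implicit Defensive.

Import GRing.Theory.
Local Open Scope ring_scope.

Definition is_multi_index (mu : seq nat) : bool :=
  (mu != [::]) && all (leq 1) mu.

Definition weight (mu : seq nat) : nat := sumn mu.

(* A subset of {1, ..., m-1} is encoded by the list of its elements in strictly
   increasing order; [of_cuts_cuts] and [cuts_of_cuts] below state that [cuts]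
   (the map S_m) and [of_cuts m] are then mutually inverse bijections. *)
Definition is_cut_set (m : nat) (s : seq nat) : bool :=
  sorted ltn s && all (fun x => 0 < x < m)%N s.

Definition cuts (mu : seq nat) : seq nat :=
  take (size mu).-1 (scanl addn 0%N mu).

Definition of_cuts (m : nat) (s : seq nat) : seq nat :=
  pairmap (fun x y => y - x)%N 0%N (rcons s m).

Definition compl_cuts (m : nat) (s : seq nat) : seq nat :=
  [seq x <- iota 1 m.-1 | x \notin s].

Definition dual (mu : seq nat) : seq nat :=
  of_cuts (weight mu) (compl_cuts (weight mu) (cuts mu)).

(* n = s_1 >= s_2 >= ... >= s_p *)
Definition chain_from (n : nat) (s : seq nat) : bool :=
  (ohead s == Some n) && sorted geq s.

(* The sequence (1, ..., 1, 2, ..., 2, ...) with mu_i copies of i, shifted to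
   indices starting at 0. *)
Definition block_indices (mu : seq nat) : seq nat :=
  flatten [seq nseq (nth 0%N mu i) i | i <- iota 0 (size mu)].

Definition qint (F : fieldType) (q : F) (n : nat) : F :=
  (1 - q ^+ n) / (1 - q).

Definition qfact (F : fieldType) (q : F) (n : nat) : F :=
  \prod_(1 <= i < n.+1) qint q i.

Definition qbinom (F : fieldType) (q : F) (n k : nat) : F :=
  qfact q n / (qfact q k * qfact q (n - k)).

Definition Delta (F : fieldType) (z : F) (a : nat -> F) : nat -> F :=
  fun n => a n - z * a n.+1.

Fixpoint Delta_q (F : fieldType) (q : F) (k : nat) (a : nat -> F) : nat -> F :=
  if k is k'.+1 then Delta (q ^+ k) (Delta_q q k' a) else a.

Definition a_seq (F : fieldType) (q : F) (mu : seq nat) (n : nat) : F :=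
  \sum_(t : (size mu).-tuple 'I_n.+1 | chain_from n (map val t))
    q ^+ (\sum_(i < size mu) (nth 0%N mu i - 1) * (tnth t i).+1)%N
    / \prod_(i < size mu) qint q (tnth t i).+1 ^+ nth 0%N mu i.

Definition c_seq (F : fieldType) (q : F) (mu nu : seq nat) (n k : nat) : F :=
  (qbinom q (n + k) n)^-1 *
  \sum_(t : (size mu).-tuple 'I_n.+1 | chain_from n (map val t))
    \sum_(u : (size nu).-tuple 'I_k.+1 | chain_from k (map val u))
      q ^+ (\sum_(i < size mu) (nth 0%N mu i - 1) * (tnth t i).+1
            + \sum_(j < size nu | 0 < j) tnth u j)%N
      / \prod_(l < weight mu)
          qint q (nth 0%N (map val t) (nth 0%N (block_indices mu) l)
                  + nth 0%N (map val u) (nth 0%N (block_indices nu) l) + 1)%N.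

Lemma mem_compl_cuts m s x :
  (x \in compl_cuts m s) = (0 < x < m)%N && (x \notin s).
Proof.
rewrite mem_filter mem_iota andbC; congr (_ && _).
by case: m => [|m]; case: x.
Qed.

Lemma is_cut_set_compl m s : is_cut_set m (compl_cuts m s).
Proof.
apply/andP; split.
  by apply: sorted_filter; [exact: ltn_trans | exact: iota_ltn_sorted].
by apply/allP => x; rewrite mem_compl_cuts => /andP[].
Qed.

Lemma rcons_cuts mu : mu != [::] ->
  rcons (cuts mu) (weight mu) = scanl addn 0%N mu.
Proof.
rewrite /cuts /weight; case: mu => // x mu _; rewrite -[sumn _]/(x + sumn mu)%N.
rewrite -[scanl _ _ _]/(x :: scanl addn x mu) -[_.-1]/(size mu).
elim: mu x => [|y mu IH] x /=; first by rewrite addn0.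
by rewrite addnA IH.
Qed.

Lemma of_cuts_cuts mu : is_multi_index mu -> of_cuts (weight mu) (cuts mu) = mu.
Proof.
case/andP=> mu0 _; rewrite /of_cuts rcons_cuts //.
by apply: scanlK => x y; rewrite addKn.
Qed.

Lemma path_ltn_scanl x mu : all (leq 1) mu -> path ltn x (scanl addn x mu).
Proof.
by elim: mu x => //= y mu IH x /andP[y0 /IH ->]; rewrite -addn1 leq_add2l y0.
Qed.

Lemma is_cut_set_cuts mu : is_multi_index mu -> is_cut_set (weight mu) (cuts mu).
Proof.
case/andP=> mu0 mu1; have := path_ltn_scanl 0 mu1; rewrite -rcons_cuts //.
move: (cuts mu) (weight mu) => s m p.
have srt : sorted ltn (0%N :: rcons s m) by [].
apply/andP; split.
  by move: p; rewrite rcons_path => /andP[/path_sorted].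
apply/allP => x xs; apply/andP; split.
  by move: p => /(order_path_min ltn_trans)/allP -> //; rewrite mem_rcons inE xs orbT.
move/path_sorted: p; rewrite -rev_sorted rev_rcons /= => p.
have tr : transitive (fun y x : nat => (x < y)%N).
  by move=> a b c ab bc; apply: ltn_trans bc ab.
by move/(order_path_min tr)/allP: p; apply; rewrite mem_rev.
Qed.

Lemma path_cut_set m s : (0 < m)%N -> is_cut_set m s -> path ltn 0 (rcons s m).
Proof.
move=> m0 /andP[srt /allP h].
have s0 : all (ltn 0) s by apply/allP => x /h /andP[].
rewrite rcons_path (path_sortedE ltn_trans) s0 srt /=.
case/lastP: s h {s0 srt} => // s x h; rewrite last_rcons.
by have /andP[] : (0 < x < m)%N by apply: h; rewrite mem_rcons mem_head.
Qed.

Lemma scanl_pairmap_subn x s : path ltn x s ->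
  scanl addn x (pairmap (fun x y => y - x)%N x s) = s.
Proof.
by elim: s x => //= y s IH x /andP[xy /IH]; rewrite subnKC ?(ltnW xy) // => ->.
Qed.

Lemma is_multi_index_of_cuts m s : (0 < m)%N -> is_cut_set m s ->
  is_multi_index (of_cuts m s).
Proof.
move=> m0 /(path_cut_set m0); rewrite /is_multi_index /of_cuts => p.
apply/andP; split; first by rewrite -size_eq0 size_pairmap size_rcons.
have H t x : path ltn x t -> all (leq 1) (pairmap (fun x y => y - x)%N x t).
  by elim: t x => //= y t IH x /andP[xy /IH ->]; rewrite subn_gt0 xy.
exact: H p.
Qed.

Lemma rcons_of_cuts m s : (0 < m)%N -> is_cut_set m s ->
  rcons (cuts (of_cuts m s)) (weight (of_cuts m s)) = rcons s m.
Proof.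
move=> m0 hs; have /andP[ne _] := is_multi_index_of_cuts m0 hs.
by rewrite rcons_cuts // scanl_pairmap_subn // path_cut_set.
Qed.

Lemma cuts_of_cuts m s : (0 < m)%N -> is_cut_set m s -> cuts (of_cuts m s) = s.
Proof. by move=> m0 /(rcons_of_cuts m0)/rcons_inj[]. Qed.

Lemma weight_of_cuts m s : (0 < m)%N -> is_cut_set m s ->
  weight (of_cuts m s) = m.
Proof. by move=> m0 /(rcons_of_cuts m0)/rcons_inj[]. Qed.

Lemma weight_gt0 mu : is_multi_index mu -> (0 < weight mu)%N.
Proof. by case: mu => //= x mu /andP[_ /andP[x0 _]]; rewrite /weight /= addn_gt0 x0. Qed.

Lemma is_multi_index_dual mu : is_multi_index mu -> is_multi_index (dual mu).
Proof.
by move/weight_gt0 => m0; apply: is_multi_index_of_cuts (is_cut_set_compl _ _).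
Qed.

Lemma weight_dual mu : is_multi_index mu -> weight (dual mu) = weight mu.
Proof.
by move/weight_gt0 => m0; apply: weight_of_cuts (is_cut_set_compl _ _).
Qed.

Lemma cuts_dual mu : is_multi_index mu ->
  cuts (dual mu) = compl_cuts (weight mu) (cuts mu).
Proof.
by move/weight_gt0 => m0; apply: cuts_of_cuts (is_cut_set_compl _ _).
Qed.

(* Main.v *)
(** Encode a multi-index of weight [m] by a word of [m - 1] bits, one for each
    element of [{1, ..., m-1}], telling whether it is a cut; duality negates the
    bits. Reading the word, [c_{mu,mu*}(n,k)] becomes a sum over lattice paths
    starting at [(n,k)] in which exactly one coordinate (which one is prescribed
    by the bit) weakly decreases at each step. Normalised by the q-binomial
    coefficient, this path sum [C_w] satisfies
      [n+k+1] C_{1w}(n,k) - [n] C_{1w}(n-1,k) = C_w(n,k),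
      [n+k+1] C_{0w}(n,k) - [k] C_{0w}(n,k-1) = q^(n+k+1) C_w(n,k),
    which propagate the relation [C(n,k+1) = C(n,k) - q^(k+1) C(n+1,k)] from [w]
    to [1w] and [0w]. As [C_w(n,0) = a_mu(n)], the theorem follows. *)
Require Import Defs.
From mathcomp Require Import all_boot all_order all_algebra.
From mathcomp Require Import reals.
From mathcomp Require Import complex.
From mathcomp Require Import ring zify.

Import GRing.Theory.
Local Open Scope ring_scope.
Local Open Scope complex_scope.

(** * Multi-indices as words *)

(** Bits are read from the front: [true] puts a new part 1 in front, [false] enlarges the first
    part. Since [compos w] is never empty, the default of [head] is never reached. *)
Fixpoint compos (w : seq bool) : seq nat :=
  match w with
  | [::] => [:: 1%N]
  | true :: w' => 1%N :: compos w'
  | false :: w' => (head 0%N (compos w')).+1 :: behead (compos w')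
  end.

Lemma compos_cons w : compos w = head 0%N (compos w) :: behead (compos w).
Proof. by case: w => [|[] w]. Qed.

Lemma compos_false w x s :
  compos w = x :: s -> compos (false :: w) = x.+1 :: s.
Proof. by move=> /= ->. Qed.

Lemma is_multi_index_compos w : is_multi_index (compos w).
Proof.
elim: w => //= -[] w /andP[_]; rewrite /is_multi_index //=.
by rewrite {1}compos_cons /= => /andP[].
Qed.

Lemma weight_compos w : weight (compos w) = (size w).+1.
Proof.
rewrite /weight; elim: w => //= -[] w IH /=; first by rewrite IH.
by rewrite addSn -IH {3}compos_cons.
Qed.

Lemma composP mu : is_multi_index mu -> exists w, mu = compos w.
Proof.
case/andP => mu0; elim: mu mu0 => // x mu IH _ /= /andP[].
case: x => // x _ mu1; elim: x => [|x [w Hw]]; last first.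
  by exists (false :: w); rewrite (compos_false _ _ _ (esym Hw)).
case: mu IH mu1 => [|y mu] IH mu1; first by exists [::].
by have [//|w ->] := IH _ mu1; exists (true :: w).
Qed.

Lemma scanl_addnS x s :
  scanl addn x.+1 s = map succn (scanl addn x s).
Proof. by elim: s x => //= y s IH x; rewrite addSn IH. Qed.

(** A new leading bit shifts every existing cut by one, and adds the cut 1 when it is [true]. *)
Lemma cuts_compos w :
  cuts (compos w) = [seq i.+1 | i <- iota 0 (size w) & nth false w i].
Proof.
elim: w => // b w IH.
have -> : iota 0 (size (b :: w)) = 0%N :: map succn (iota 0 (size w)).
  by rewrite /= (iotaDl 1 0).
rewrite [filter _ _]/= filter_map.
rewrite (eq_filter (_ : preim succn (nth false (b :: w)) =1 nth false w)) //.
case Ew: (compos w) => [|x s]; first by move: Ew; rewrite compos_cons.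
rewrite /cuts Ew /= in IH *.
by case: b; rewrite /= Ew /= -IH ?add1n !add0n map_take /= -scanl_addnS.
Qed.

Lemma dual_compos w : dual (compos w) = compos (map negb w).
Proof.
have mi := is_multi_index_compos (map negb w).
rewrite /dual -[RHS](of_cuts_cuts mi) !weight_compos size_map.
congr of_cuts; rewrite !cuts_compos /compl_cuts size_map /=.
rewrite (iotaDl 1 0) filter_map; congr map.
apply: eq_in_filter => i; rewrite mem_iota /= add0n => iw.
rewrite (mem_map succn_inj) mem_filter mem_iota /= add0n iw andbT.
by rewrite (nth_map false).
Qed.

(** * Path sums *)

Section PathSums.
Context (F : fieldType) (q : F).

(** A [false] bit adds one to the first part of mu, whence [q ^+ n.+1], and opens a new index j on
    the k side, whence [q ^+ j]. *)
Fixpoint path_sum (w : seq bool) (n k : nat) : F :=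
  match w with
  | [::] => (qint q (n + k + 1))^-1
  | true :: w' =>
      (qint q (n + k + 1))^-1 * \sum_(i < n.+1) path_sum w' i k
  | false :: w' =>
      q ^+ n.+1 / qint q (n + k + 1) * \sum_(j < k.+1) q ^+ j * path_sum w' n j
  end.

Definition conn (w : seq bool) (n k : nat) : F :=
  path_sum w n k / qbinom q (n + k) n.

Lemma qint0 : qint q 0 = 0.
Proof. by rewrite /qint expr0 subrr mul0r. Qed.

Lemma qintD m n : qint q (m + n) = qint q m + q ^+ m * qint q n.
Proof. by rewrite /qint exprD; ring. Qed.

Lemma qfactS n : qfact q n.+1 = qfact q n * qint q n.+1.
Proof. by rewrite /qfact big_nat_recr. Qed.

Lemma qfact0 : qfact q 0 = 1.
Proof. by rewrite /qfact big_geq. Qed.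

(** As [q] may be a root of unity, only the q-integers up to a bound are assumed nonzero; the size
    conditions below keep the denominators within it. *)
Context (N : nat) (qint_neq0 : forall j, (0 < j <= N)%N -> qint q j != 0).

Lemma qfact_neq0 n : (n <= N)%N -> qfact q n != 0.
Proof.
elim: n => [|n IH] nN; first by rewrite qfact0 oner_eq0.
by rewrite qfactS mulf_neq0 ?IH ?qint_neq0 ?nN // ltnW.
Qed.

Lemma qbinom_neq0 n k : (n + k <= N)%N -> qbinom q (n + k) n != 0.
Proof.
by move=> nkN; rewrite /qbinom addKn !mulf_neq0 ?invr_eq0 ?mulf_neq0 ?qfact_neq0 //; lia.
Qed.

(** Absorption identity: with its companion for [k], it moves the q-binomial normalisation by one
    lattice step. *)
Lemma mul_qbinom_diag n k : (n.+1 + k <= N)%N ->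
  qint q n.+1 * qbinom q (n.+1 + k) n.+1 = qint q (n + k + 1) * qbinom q (n + k) n.
Proof.
move=> nkN; rewrite /qbinom !addKn addSn !qfactS addn1.
by field; rewrite !qfact_neq0 ?qint_neq0 //; lia.
Qed.

Lemma mul_qbinom_down n k : (n + k.+1 <= N)%N ->
  qint q k.+1 * qbinom q (n + k.+1) n = qint q (n + k + 1) * qbinom q (n + k) n.
Proof.
move=> nkN; rewrite /qbinom !addKn addnS !qfactS addn1.
by field; rewrite !qfact_neq0 ?qint_neq0 //; lia.
Qed.

(** At q = 1 the quotient would be 0/0, read as 0; nonvanishing at index 1 excludes this case. *)
Lemma qint1 : (0 < N)%N -> qint q 1 = 1.
Proof.
move=> N0; have := @qint_neq0 1%N N0; rewrite /qint expr1 => q1.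
by rewrite divff //; apply: contraNneq q1 => ->; rewrite mul0r.
Qed.

Lemma qintS n : (0 < N)%N -> qint q n.+1 = qint q n + q ^+ n.
Proof. by move=> N0; rewrite -addn1 qintD qint1 // mulr1. Qed.

Lemma qintSl n : (0 < N)%N -> qint q n.+1 = 1 + q * qint q n.
Proof. by move=> N0; rewrite -add1n qintD qint1 // expr1. Qed.

(* At [n = 0] the junk index [0.-1] is harmless since [qint q 0 = 0]; likewise
   for [k = 0] in [conn_false]. *)
Lemma conn_true w n k : (n + k + 1 <= N)%N ->
  qint q (n + k + 1) * conn (true :: w) n k =
  conn w n k + qint q n * conn (true :: w) n.-1 k.
Proof.
move=> nkN; have nk0 : qint q (n + k + 1) != 0 by apply: qint_neq0; lia.
rewrite /conn /= mulrA mulVKf //.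
case: n nkN nk0 => [|n] nkN nk0; first by rewrite big_ord1 qint0 mul0r addr0.
(* The last term of the sum gives [conn w]; the others form the sum at [n], renormalised by
   absorption. *)
rewrite big_ord_recr /= mulrDl addrC; congr (_ + _).
have nk0' : qint q (n + k + 1) != 0 by apply: qint_neq0; lia.
have b0 : qbinom q (n + k) n != 0 by apply: qbinom_neq0; lia.
have b1 : qbinom q (n.+1 + k) n.+1 != 0 by apply: qbinom_neq0; lia.
have := @mul_qbinom_diag n k; move=> /(_ ltac:(lia)) e.
set S := \sum_(i < _) _; apply: (mulIf b1); rewrite mulfVK //.
transitivity ((qint q n.+1 * qbinom q (n.+1 + k) n.+1) *
  ((qint q (n + k + 1))^-1 * S / qbinom q (n + k) n)).
  by rewrite e; field; rewrite nk0' b0.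
by ring.
Qed.

Lemma conn_false w n k : (n + k + 1 <= N)%N ->
  qint q (n + k + 1) * conn (false :: w) n k =
  q ^+ (n + k + 1) * conn w n k + qint q k * conn (false :: w) n k.-1.
Proof.
move=> nkN; have nk0 : qint q (n + k + 1) != 0 by apply: qint_neq0; lia.
have b1 : qbinom q (n + k) n != 0 by apply: qbinom_neq0; lia.
rewrite /conn /=.
case: k nkN nk0 b1 => [|k] nkN nk0 b1.
  rewrite big_ord1 qint0 mul0r addr0 expr0 mul1r addn1 addn0 in nk0 b1 *.
  by field; rewrite nk0 b1.
rewrite big_ord_recr /=.
have nk0' : qint q (n + k + 1) != 0 by apply: qint_neq0; lia.
have b0 : qbinom q (n + k) n != 0 by apply: qbinom_neq0; lia.
have := @mul_qbinom_down n k; move=> /(_ ltac:(lia)) e.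
have -> : q ^+ (n + k.+1 + 1) = q ^+ n.+1 * q ^+ k.+1.
  by rewrite -exprD; congr (_ ^+ _); lia.
set S := \sum_(i < _) _; set P := path_sum _ _ _.
apply: (mulIf b1).
transitivity (q ^+ n.+1 * (S + q ^+ k.+1 * P)); first by field; rewrite nk0 b1.
transitivity (q ^+ n.+1 * q ^+ k.+1 * P + (qint q k.+1 * qbinom q (n + k.+1) n) *
  (q ^+ n.+1 / qint q (n + k + 1) * S / qbinom q (n + k) n)).
  by rewrite e; field; rewrite nk0' b0.
by field; rewrite b1 nk0' b0.
Qed.

Lemma conn_nil n k : (n + k + 1 <= N)%N ->
  conn [::] n k = qfact q n * qfact q k / qfact q (n + k + 1).
Proof.
move=> nkN; rewrite /conn /= /qbinom addKn addn1 qfactS.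
by field; rewrite !qfact_neq0 ?qint_neq0 //; lia.
Qed.

(** The empty word reduces to [n+k+2] = [k+1] + q^(k+1) [n+1]. For a longer word the defect [D]
    satisfies a homogeneous recurrence in one coordinate, whose coefficient [n] or q[k] vanishes on
    the boundary; hence [D] is zero. *)
Lemma conn_step w n k : (n + k + 2 <= N)%N ->
  conn w n k.+1 = conn w n k - q ^+ k.+1 * conn w n.+1 k.
Proof.
elim: w n k => [|b w IH] n k nkN.
  have E : qint q (n + k + 2) = qint q k.+1 + q ^+ k.+1 * qint q n.+1.
    by rewrite -qintD; congr qint; lia.
  rewrite !conn_nil; try lia.
  have -> : (n + k.+1 + 1 = (n + k + 1).+1)%N by lia.
  have -> : (n.+1 + k + 1 = (n + k + 1).+1)%N by lia.
  rewrite !qfactS (_ : (n + k + 1).+1 = n + k + 2)%N; last by lia.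
  have f0 : qfact q (n + k + 1) != 0 by apply: qfact_neq0; lia.
  have i0 : qint q (n + k + 2) != 0 by apply: qint_neq0; lia.
  rewrite E in i0 *.
  by field; rewrite f0 i0.
have nk0 m l : (m + l + 2 <= N)%N -> qint q (m + l + 2) != 0.
  by move=> ?; apply: qint_neq0; lia.
have q1 : (1 <= N)%N by lia.
pose D m l := conn (b :: w) m l - q ^+ l.+1 * conn (b :: w) m.+1 l
                - conn (b :: w) m l.+1.
suff : D n k = 0 by move/eqP; rewrite subr_eq0 => /eqP.
have j1 m l : qint q (m + l + 2) = qint q (m + l + 1) + q ^+ (m + l + 1).
  by rewrite -qintS //; congr qint; lia.
case: b @D => D.
- have HD m l : (m + l + 2 <= N)%N ->
    qint q (m + l + 2) * D m l = qint q m * D m.-1 l.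
    move=> mlN; have := IH _ _ mlN.
    have /(canRL (addrK _)) -> := esym (conn_true w m l ltac:(lia)).
    have /(canRL (addrK _)) -> := esym (conn_true w m.+1 l ltac:(lia)).
    have /(canRL (addrK _)) -> := esym (conn_true w m l.+1 ltac:(lia)).
    have -> : (m.+1 + l + 1 = m + l + 2)%N by lia.
    have -> : (m + l.+1 + 1 = m + l + 2)%N by lia.
    rewrite [m.+1.-1]/= => eG.
    (* Replaces [m.-1.+1] by [m] inside [D m.-1 l]; at m = 0 these differ, but the factor [0] kills
       both sides. *)
    transitivity (qint q m * (conn (true :: w) m.-1 l
        - q ^+ l.+1 * conn (true :: w) m l - conn (true :: w) m.-1 l.+1)); last first.
      by case: m {mlN eG} => [|m] //; rewrite qint0 !mul0r.
    move/eqP: eG; rewrite -subr_eq0 => /eqP eG.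
    apply/eqP; rewrite -subr_eq0 -oppr_eq0 -eG /D; apply/eqP.
    (* Splitting [m+1] = [m] + q^m produces the term in q^(m+l+1) that [j1] splits off from
       [m+l+2]. *)
    have -> : q ^+ l.+1 * ((qint q (m + l + 2) * conn (true :: w) m.+1 l)
        - qint q m.+1 * conn (true :: w) m l) =
      q ^+ l.+1 * (qint q (m + l + 2) * conn (true :: w) m.+1 l)
        - q ^+ l.+1 * qint q m * conn (true :: w) m l
        - q ^+ (m + l + 1) * conn (true :: w) m l.
      by rewrite qintS // addn1 -addnS exprD; ring.
    by rewrite j1; ring.
  elim: n nkN => [|n IHn] nkN; apply: (mulfI (nk0 _ _ nkN)); rewrite mulr0 HD //.
    by rewrite qint0 mul0r.
  by rewrite IHn ?mulr0 //; lia.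
- have HD m l : (m + l + 2 <= N)%N ->
    qint q (m + l + 2) * D m l = q * qint q l * D m l.-1.
    (* The power q^(m+l+2) is the one in [conn_false] at (m+1,l) and (m,l+1); at (m,l) it exceeds
       the required power by one, hence the [q] in the recurrence for [D]. *)
    move=> mlN; have := congr1 ( *%R (q ^+ (m + l + 2))) (IH _ _ mlN).
    have /(canRL (addrK _)) := esym (conn_false w m l ltac:(lia)).
    have /(canRL (addrK _)) := esym (conn_false w m.+1 l ltac:(lia)).
    have /(canRL (addrK _)) := esym (conn_false w m l.+1 ltac:(lia)).
    have -> : (m.+1 + l + 1 = m + l + 2)%N by lia.
    have -> : (m + l.+1 + 1 = m + l + 2)%N by lia.
    rewrite [l.+1.-1]/= => e3 e2 e1.
    rewrite mulrBr (mulrCA _ (q ^+ l.+1)) e2 e3 => eG.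
    have {}eG : qint q (m + l + 2) * conn (false :: w) m l.+1
          - qint q l.+1 * conn (false :: w) m l =
        q * (qint q (m + l + 1) * conn (false :: w) m l
             - qint q l * conn (false :: w) m l.-1)
        - q ^+ l.+1 * (qint q (m + l + 2) * conn (false :: w) m.+1 l
             - qint q l * conn (false :: w) m.+1 l.-1).
      by rewrite eG -e1 mulrA -exprS; congr (_ ^+ _ * _ - _); lia.
    transitivity (q * qint q l * (conn (false :: w) m l.-1
        - q ^+ l * conn (false :: w) m.+1 l.-1 - conn (false :: w) m l)); last first.
      by case: l {mlN eG e1 e2 e3} => [|l] //; rewrite qint0 !mulr0 !mul0r.
    move/eqP: eG; rewrite -subr_eq0 => /eqP eG.
    apply/eqP; rewrite -subr_eq0 -oppr_eq0 -eG /D; apply/eqP.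
    have i2 : qint q (m + l + 2) = 1 + q * qint q (m + l + 1).
      by rewrite -qintSl //; congr qint; lia.
    rewrite [qint q l.+1]qintSl // i2 exprS; ring.
  elim: k nkN => [|k IHk] nkN; apply: (mulfI (nk0 _ _ nkN)); rewrite mulr0 HD //.
    by rewrite qint0 mulr0 mul0r.
  by rewrite IHk ?mulr0 //; lia.
Qed.

(** The outermost operator of [Delta_q] has parameter q^k, so each further difference is one use of
    [conn_step]. *)
Lemma Delta_q_conn w (a : nat -> F) n k :
  (forall m, (m + 1 <= N)%N -> a m = conn w m 0) ->
  (n + k + 1 <= N)%N -> Delta_q q k a n = conn w n k.
Proof.
move=> ha; elim: k n => [|k IHk] n nkN; first by rewrite /= ha //; lia.
by rewrite /= /Delta !IHk ?conn_step //; lia.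
Qed.

End PathSums.

(** * Chains *)

(** Plain lists replace tuples of ordinals so that each entry can serve as the bound of its tail, as
    the recursion of [path_sum] requires. *)
Fixpoint chains (n p : nat) : seq (seq nat) :=
  if p is p'.+1 then [seq x :: s | x <- iota 0 n.+1, s <- chains x p'] else [:: [::]].

Lemma chainsS n p :
  chains n p.+1 = [seq x :: s | x <- iota 0 n.+1, s <- chains x p].
Proof. by []. Qed.

Lemma mem_chains n p s :
  (s \in chains n p) = (size s == p) && path geq n s.
Proof.
elim: p n s => [|p IH] n s; first by rewrite inE; case: s.
rewrite chainsS; apply/allpairsPdep/idP => [[x [t []]]|].
  by rewrite mem_iota add0n ltnS IH => /= xn /andP[/eqP <- pt] ->; rewrite /= eqxx xn.
case: s => [|x t] //=; rewrite eqSS => /and3P[st xn pt].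
by exists x, t; rewrite -[_ :: _]/(iota 0 n.+1) mem_iota add0n ltnS xn IH st pt.
Qed.

Lemma uniq_chains n p : uniq (chains n p).
Proof.
elim: p n => // p IH n; rewrite chainsS; apply: allpairs_uniq_dep.
- exact: iota_uniq.
- by move=> x _; apply: IH.
- by move=> [x s] [y t] _ _ /= [-> ->].
Qed.

Lemma chain_from_chains n p (t : p.+1.-tuple 'I_n.+1) :
  chain_from n (map val t) = (map val t \in [seq n :: s | s <- chains n p]).
Proof.
case/tupleP: t => x t; rewrite /chain_from /=.
apply/andP/mapP => [[/eqP[xn] pt]|[s]].
  exists (map val t); last by rewrite xn.
  by rewrite mem_chains size_map size_tuple eqxx -{1}xn.
by rewrite mem_chains => /andP[_ ps] [-> ->]; rewrite eqxx.
Qed.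

Lemma sum_chain_from (F : fieldType) n p (f : seq nat -> F) :
  \sum_(t : p.+1.-tuple 'I_n.+1 | chain_from n (map val t)) f (map val t) =
  \sum_(s <- chains n p) f (n :: s).
Proof.
rewrite -(big_map (cons n) xpredT f).
set h : p.+1.-tuple 'I_n.+1 -> seq nat := fun t => map val t.
rewrite -[LHS](big_map h (chain_from n) f) -big_filter.
apply/perm_big/uniq_perm.
- apply: filter_uniq; rewrite map_inj_uniq ?index_enum_uniq // => t u.
  by move/(inj_map val_inj)/val_inj.
- by rewrite map_inj_uniq ?uniq_chains // => s t [].
move=> s; rewrite mem_filter; apply/andP/idP => [[cs /mapP[t _ E]]|/mapP[t ct ->]].
  by rewrite {}E in cs *; rewrite -chain_from_chains.
move: (ct); rewrite mem_chains => /andP[/eqP st pt].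
(* All entries are at most [n], so [inord] loses nothing and the list lifts to a tuple. *)
have st' : size (map (@inord n) (n :: t)) == p.+1 by rewrite size_map /= st.
have E : n :: t = h (Tuple st').
  rewrite /h /= -map_comp; congr (_ :: _); first by rewrite /= inordK.
  rewrite -[LHS]map_id; apply/eq_in_map => x xt /=; rewrite inordK //.
  by move: pt => /(order_path_min (rev_trans leq_trans))/allP/(_ _ xt).
split; first by rewrite /chain_from /= eqxx.
by rewrite E; apply: (map_f h); rewrite mem_index_enum.
Qed.

(** * The summand along a word *)

Lemma block_indices_cons x mu :
  block_indices (x :: mu) = nseq x 0%N ++ map succn (block_indices mu).
Proof.
rewrite /block_indices /= (iotaDl 1 0) -map_comp; congr (_ ++ _).
rewrite map_flatten -map_comp; congr flatten.
by apply: eq_map => i /=; rewrite map_nseq.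
Qed.

Lemma size_block_indices mu : size (block_indices mu) = weight mu.
Proof.
elim: mu => // x mu IH.
by rewrite block_indices_cons size_cat size_nseq size_map IH.
Qed.

Lemma big_weight_nth (F : fieldType) (f : nat -> F) mu :
  \prod_(l < weight mu) f (nth 0%N (block_indices mu) l) =
  \prod_(i <- block_indices mu) f i.
Proof. by rewrite (big_nth 0%N) size_block_indices big_mkord. Qed.

Lemma prod_block_indices (F : fieldType) (f : nat -> F) mu :
  \prod_(i <- block_indices mu) f i = \prod_(i < size mu) f i ^+ nth 0%N mu i.
Proof.
elim: mu f => [|x mu IH] f; first by rewrite big_nil big_ord0.
rewrite block_indices_cons big_cat big_map /= IH big_ord_recl; congr (_ * _).
by rewrite big_nseq iter_mulr_1.
Qed.

Section Summand.
Context (F : fieldType) (q : F).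

Definition summand (mu nu s r : seq nat) : F :=
  q ^+ (\sum_(i < size mu) (nth 0%N mu i - 1) * (nth 0%N s i).+1
        + \sum_(j < size nu | 0 < j) nth 0%N r j)%N
  / \prod_(l < weight mu)
      qint q (nth 0%N s (nth 0%N (block_indices mu) l)
              + nth 0%N r (nth 0%N (block_indices nu) l) + 1)%N.

Lemma nth_tnth p n (t : p.-tuple 'I_n) (i : 'I_p) :
  nth 0%N (map val t) i = tnth t i.
Proof. by rewrite -tnth_map (tnth_nth 0%N). Qed.

Lemma c_seqE x mu y nu n k :
  c_seq q (x :: mu) (y :: nu) n k =
  (qbinom q (n + k) n)^-1 *
  \sum_(s <- chains n (size mu)) \sum_(r <- chains k (size nu))
     summand (x :: mu) (y :: nu) (n :: s) (k :: r).
Proof.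
rewrite /c_seq; congr (_ * _).
under eq_bigr => t _.
  under eq_bigr => u _.
    under eq_bigr => i _ do rewrite -nth_tnth.
    under [X in (_ + X)%N]eq_bigr => j _ do rewrite -nth_tnth.
    over.
  rewrite (sum_chain_from _ k (size nu) (summand (x :: mu) (y :: nu) (map val t))).
  over.
by rewrite (sum_chain_from _ n (size mu) (fun s => \sum_(r <- _) summand _ _ s (k :: r))).
Qed.

Lemma head_exponent (y : nat) nu k r :
  (\sum_(j < size (y :: nu) | 0 < j) nth 0%N (k :: r) j
   = \sum_(j < size nu) nth 0%N r j)%N.
Proof. by rewrite big_mkcond big_ord_recl /= add0n. Qed.

Lemma nth_map_succ_block mu l : (l < weight mu)%N ->
  nth 0%N (map succn (block_indices mu)) l = (nth 0%N (block_indices mu) l).+1.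
Proof. by move=> lt_l; rewrite (nth_map 0%N) // size_block_indices. Qed.

Lemma block_indices_incr x mu :
  block_indices (x.+1 :: mu) = 0%N :: block_indices (x :: mu).
Proof. by rewrite !block_indices_cons. Qed.

(** The new part 1 of mu has exponent 0; the extra factor pairs the two leading indices [n] and
    [k]. *)
Lemma summand_true mu y nu n k s r :
  weight mu = weight (y :: nu) ->
  summand (1%N :: mu) (y.+1 :: nu) (n :: s) (k :: r) =
  (qint q (n + k + 1))^-1 * summand mu (y :: nu) s (k :: r).
Proof.
move=> wE; rewrite /summand -[weight (1%N :: mu)]/(weight mu).+1.
rewrite [X in q ^+ (X + _)]big_ord_recl [X in _ / X]big_ord_recl.
rewrite (block_indices_cons 1) (block_indices_incr y) !head_exponent /=.
rewrite subnn mul0n add0n invfM mulrCA; congr (_ * (_ / _)).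
by apply: eq_bigr => l _; rewrite nth_map_succ_block ?ltn_ord.
Qed.

Lemma summand_false x mu y nu n k s j r :
  weight (x :: mu) = weight (y :: nu) -> (0 < x)%N ->
  summand (x.+1 :: mu) (1%N :: y :: nu) (n :: s) (k :: j :: r) =
  q ^+ n.+1 / qint q (n + k + 1) *
  (q ^+ j * summand (x :: mu) (y :: nu) (n :: s) (j :: r)).
Proof.
move=> wE x0; rewrite /summand -[weight (x.+1 :: mu)]/(weight (x :: mu)).+1.
rewrite [X in _ / X = _]big_ord_recl.
rewrite (block_indices_incr x) (block_indices_cons 1) !head_exponent.
set P' := (X in _ = _ * (_ * (_ / X))).
rewrite [X in _ / (_ * X) = _](_ : _ = P'); last first.
  rewrite /P'; apply: eq_bigr => l _; rewrite lift0; congr (qint q (_ + _ + _)%N).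
  (* Equal weights keep [l] in range, so the default of [nth] does not interfere with the shift by
     [succn]. *)
  have lt_l : (l < weight (y :: nu))%N by rewrite -wE.
  by rewrite [nth 0%N (nseq _ _ ++ _) _]/= nth_map_succ_block.
rewrite ![(\sum_(i < size (_ :: _)) _)%N]big_ord_recl /= subn1 /=.
(* Writing x as (x-1)+1 isolates the single factor q^(n+1) due to the enlarged part. *)
rewrite -[x in LHS](prednK x0) mulSn invfM -!addnA !exprD.
rewrite [(x - 1)%N]subn1; ring.
Qed.

Lemma sum_summand w n k :
  \sum_(s <- chains n (size (compos w)).-1)
    \sum_(r <- chains k (size (compos (map negb w))).-1)
      summand (compos w) (compos (map negb w)) (n :: s) (k :: r) =
  path_sum F q w n k.
Proof.
have wE v : weight (compos v) = weight (compos (map negb v)).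
  by rewrite !weight_compos size_map.
elim: w n k => [|b w IH] n k.
  rewrite /= !big_seq1 /summand /weight /= !big_ord1 big_mkcond big_ord1.
  by rewrite mul0n expr0 mul1r.
have := is_multi_index_compos w; have := is_multi_index_compos (map negb w).
have := wE w; have := compos_cons w; have := compos_cons (map negb w).
move: (head _ _) (behead _) => y nu eN; move: (head _ _) (behead _) => x mu eM.
rewrite eM eN => {}wE /andP[_ /andP[y0 _]] /andP[_ /andP[x0 _]].
rewrite eM eN in IH; case: b => /=.
- rewrite eM eN chainsS big_allpairs_dep -[iota 0 n.+1]/(index_iota 0 n.+1).
  rewrite big_mkord mulr_sumr; apply: eq_bigr => i _; rewrite -IH mulr_sumr.
  apply: eq_bigr => s _; rewrite mulr_sumr; apply: eq_bigr => r _.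
  exact: summand_true.
(* Here it is the k-chain that grows, so its sum is brought outside to extract j and then exchanged
   back to match the induction hypothesis. *)
rewrite eM eN chainsS exchange_big big_allpairs_dep /=.
rewrite -[0%N :: iota 1 k]/(index_iota 0 k.+1) big_mkord mulr_sumr.
apply: eq_bigr => j _; rewrite -IH exchange_big !mulr_sumr.
apply: eq_bigr => s _; rewrite !mulr_sumr; apply: eq_bigr => r _.
exact: summand_false.
Qed.

Lemma chains0 p : chains 0 p = [:: nseq p 0%N].
Proof. by elim: p => //= p ->. Qed.

(** At k = 0 the second chain consists of zeros, whatever [nu] is, and the q-binomial is 1. *)
Lemma a_seq_c_seq mu nu n :
  qfact q n != 0 -> nu != [::] -> a_seq q mu n = c_seq q mu nu n 0.
Proof.
move=> f0; case: nu => // y nu _.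
rewrite /a_seq /c_seq addn0 /qbinom subnn qfact0 mulr1 divff // invr1 mul1r.
apply: eq_bigr => t _.
transitivity (\sum_(u : (size nu).+1.-tuple 'I_1 | chain_from 0 (map val u))
    summand mu (y :: nu) (map val t) (map val u)); last first.
  apply: eq_bigr => u _; congr (q ^+ (_ + _) / _).
    by apply: eq_bigr => i _; rewrite -nth_tnth.
  by apply: eq_bigr => i _; rewrite -nth_tnth.
rewrite sum_chain_from chains0 big_seq1 -[0%N :: _]/(nseq (size nu).+1 0%N) /summand.
have nth0 i : nth 0%N (nseq (size nu).+1 0%N) i = 0%N by rewrite nth_nseq if_same.
under [X in (_ + X)%N]eq_bigr do rewrite nth0.
rewrite [X in (_ + X)%N]big1 // addn0.
under [X in _ = _ / X]eq_bigr do rewrite nth0 addn0 addn1.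
rewrite (big_weight_nth _ (fun i => qint q (nth 0%N (map val t) i).+1)).
rewrite prod_block_indices; congr (q ^+ _ / _).
  by apply: eq_bigr => i _; rewrite nth_tnth.
by apply: eq_bigr => i _; rewrite nth_tnth.
Qed.

End Summand.

(** * Connected sums as normalised path sums, and the duality *)

Lemma c_seq_compos (F : fieldType) (q : F) w n k :
  c_seq q (compos w) (compos (map negb w)) n k = conn F q w n k.
Proof.
rewrite [compos w]compos_cons [compos (map _ w)]compos_cons c_seqE /conn.
have := sum_summand F q w n k.
rewrite [compos w]compos_cons [compos (map _ w)]compos_cons => ->.
by rewrite mulrC.
Qed.

(** The hypothesis [hqint] makes the denominators meaningful: [n+k+1] is the largest q-integer in
    both a_mu(n+k) and c(n,k). *)
Theorem corollary3p9 (R : realType) (q : R[i]) (hq0 : q != 0) (hq1 : q != 1)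
    (mu : seq nat) (hmu : is_multi_index mu) (n k : nat)
    (hqint : forall j : nat, (0 < j <= n + k + 1)%N -> qint q j != 0) :
  Delta_q q k (a_seq q mu) n = c_seq q mu (dual mu) n k.
Proof.
have [w ->] := composP _ hmu; rewrite dual_compos c_seq_compos.
apply: (Delta_q_conn _ _ _ hqint) => // m mN.
have f0 : qfact q m != 0 by apply: (qfact_neq0 _ _ _ hqint); lia.
rewrite (a_seq_c_seq _ _ _ (compos (map negb w))) ?c_seq_compos //.
by rewrite compos_cons.
Qed.
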